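(* Let $G$ be a graph with $n$ vertices and $k\in\mathbb{N}$. There is a local $L$-sequence of length $k$ in $G$ if and only if there is a $\{T,D\}$-forcing set of size $n-k$ in $G$.
   Context: For a vertex $v$, $N(v)$ is the open and $N[v]=N(v)\cup\{v\}$ the closed neighborhood. A sequence $(v_1,\dots,v_k)$ of pairwise distinct vertices of $G$ is a \emph{local $L$-sequence} if for all $i$ the set $(N[v_i]\cap\{v_1,\dots,v_i\})\setminus\bigcup_{j=1}^{i-1}N(v_j)$ is nonempty. Vertices are colored blue or white. \emph{$T$-rule}: if $v$ is white and has exactly one white neighbor $w$, color $w$ blue. \emph{$D$-rule}: if $v$ is white and every neighbor of $v$ is blue, color $v$ blue. A set $S\subseteq V(G)$ is a \emph{$\{T,D\}$-forcing set} if, starting with $S$ blue and all other vertices white, iteratively applying $T$-rules and $D$-rules can color all vertices blue. *)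

(* Defs.v *)
From mathcomp Require Import all_boot.

Set Implicit Arguments.
Unset Strict Implicit.
Unset Printing Implicit Defensive.

(* A finite simple graph is a symmetric irreflexive relation e on a finType. *)
Section LocalLSequences.

Variables (V : finType) (e : rel V).

Definition open_nbhd (v : V) : {set V} := [set u | e v u].

Definition closed_nbhd (v : V) : {set V} := v |: open_nbhd v.

Definition local_L_sequence (k : nat) (s : k.-tuple V) : Prop :=
  uniq s /\
  forall i : 'I_k,
    (closed_nbhd (tnth s i) :&: [set tnth s j | j : 'I_k & j <= i])
      :\: \bigcup_(j : 'I_k | j < i) open_nbhd (tnth s j) != set0.

(* A colouring is given by its set B of blue vertices. *)
Definition T_rule (B B' : {set V}) : bool :=
  [exists v, exists w,
    [&& v \notin B, open_nbhd v :\: B == [set w] & B' == w |: B]].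

Definition D_rule (B B' : {set V}) : bool :=
  [exists v, [&& v \notin B, open_nbhd v \subset B & B' == v |: B]].

Definition TD_step : rel {set V} := [rel B B' | T_rule B B' || D_rule B B'].

Definition TD_forcing_set (S : {set V}) : bool := connect TD_step S [set: V].

End LocalLSequences.

(* Main.v *)
Require Import Defs.
From mathcomp Require Import all_boot.

(** Reversing a local L-sequence gives a forcing order on its complement, and
    conversely. When [v_1, ..., v_i] are the white vertices, a witness of the
    L-condition at [i] is a white [u] in [N[v_i]] with no neighbour among
    [v_1, ..., v_(i-1)]: if [u = v_i] this is the D-rule at [v_i], otherwise
    [v_i] is the only white neighbour of [u] and this is the T-rule at [u]. *)

Set Implicit Arguments.
Unset Strict Implicit.
Unset Printing Implicit Defensive.

Section Footprints.

Variables (V : finType) (e : rel V).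
Hypotheses (e_sym : symmetric e) (e_irr : irreflexive e).

(** The L-condition for one vertex, freed of indices: [s] lists the vertices before [x], and [u] is
    the witness. *)
Definition footprints (s : seq V) (x : V) : Prop :=
  exists u, [/\ u \in rcons s x, u \in closed_nbhd e x
              & forall y, y \in s -> ~~ e y u].

(** Growth at the end lets induction strip the last vertex, which is the first one coloured in the
    reversed process. *)
Inductive L_seq : seq V -> Prop :=
| L_seq_nil : L_seq [::]
| L_seq_rcons s x :
    L_seq s -> x \notin s -> footprints s x -> L_seq (rcons s x).

Lemma L_seq_uniq s : L_seq s -> uniq s.
Proof. by elim=> // {}s x _ us xs _; rewrite rcons_uniq xs. Qed.

Lemma L_seq_footprints x0 s i :
  L_seq s -> i < size s -> footprints (take i s) (nth x0 s i).
Proof.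
move=> Ls; elim: Ls i => // {}s x _ IH _ fx i; rewrite size_rcons ltnS.
rewrite leq_eqVlt => /orP[/eqP->|lt_i].
  by rewrite nth_rcons ltnn eqxx -cats1 take_size_cat.
by rewrite nth_rcons lt_i -cats1 takel_cat ?(ltnW lt_i) //; apply: IH.
Qed.

Lemma L_seqP x0 s :
  L_seq s <->
  uniq s /\ (forall i, i < size s -> footprints (take i s) (nth x0 s i)).
Proof.
split=> [Ls|[]].
  by split=> [|i]; [apply: L_seq_uniq | apply: L_seq_footprints].
elim/last_ind: s => [|s x IH]; first by constructor.
rewrite rcons_uniq => /andP[xs us] fs; constructor=> //.
- apply: IH => // i lt_i; have := fs i; rewrite size_rcons ltnS ltnW //.
  by rewrite nth_rcons lt_i -cats1 takel_cat ?(ltnW lt_i) //; apply.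
- have := fs (size s); rewrite size_rcons ltnSn nth_rcons ltnn eqxx.
  by rewrite -cats1 take_size_cat //; apply.
Qed.

Lemma mem_take_tnth k (s : k.-tuple V) i y :
  reflect (exists2 j : 'I_k, j < i & y = tnth s j) (y \in take i s).
Proof.
apply: (iffP (nthP y)) => [[j]|[j lt_ji def_y]].
  rewrite size_take_min leq_min => /andP[lt_ji]; rewrite size_tuple => lt_jk <-.
  by exists (Ordinal lt_jk); rewrite ?nth_take ?(tnth_nth y).
exists j; first by rewrite size_take_min size_tuple leq_min lt_ji ltn_ord.
by rewrite nth_take // -tnth_nth.
Qed.

Lemma local_L_footprints k (s : k.-tuple V) (i : 'I_k) :
  (closed_nbhd e (tnth s i) :&: [set tnth s j | j : 'I_k & j <= i])
      :\: \bigcup_(j : 'I_k | j < i) open_nbhd e (tnth s j) != set0 <->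
  footprints (take i s) (tnth s i).
Proof.
(* The vertices of index at most [i] form [take i.+1 s], so [mem_take_tnth] covers both index
   ranges; [tnth s i] itself is the default for [nth]. *)
rewrite /footprints [X in rcons _ X](tnth_nth (tnth s i)).
rewrite -take_nth ?size_tuple //.
split=> [/set0Pn[u]|[u [u_s u_x u_new]]].
  rewrite inE in_setI => /andP[/bigcupP u_new /andP[u_x /imsetP[j]]].
  rewrite inE => le_ji def_u; exists u; split=> //.
    by apply/mem_take_tnth; exists j.
  move=> y /mem_take_tnth[m lt_mi ->]; apply/negP=> e_mu.
  by case: u_new; exists m; rewrite ?inE.
apply/set0Pn; exists u; rewrite inE in_setI u_x /=; apply/andP; split.
  apply/bigcupP=> -[j lt_ji]; rewrite inE; apply/negP/u_new.
  by apply/mem_take_tnth; exists j.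
by have /mem_take_tnth[j le_ji ->] := u_s; apply: imset_f; rewrite inE.
Qed.

Lemma local_L_sequenceP k (s : k.-tuple V) : local_L_sequence e s <-> L_seq s.
Proof.
(* Length 0 is treated apart because [V] may then be empty, while [L_seqP] asks for a default
   vertex. *)
case: k s => [|k] s.
  rewrite tuple0; split=> _; first exact: L_seq_nil.
  by split=> // -[].
have x0 := tnth s ord0; split=> [[us Ls]|].
  apply/(L_seqP x0); split=> // i; rewrite size_tuple => lt_i.
  have /local_L_footprints := Ls (Ordinal lt_i).
  by rewrite (tnth_nth x0).
case/(L_seqP x0) => us fs; split=> // i; apply/local_L_footprints.
by rewrite (tnth_nth x0); apply: fs; rewrite size_tuple.
Qed.

Lemma footprints_step s x : x \notin s -> footprints s x ->
  TD_step e (~: [set:: rcons s x]) (~: [set:: s]).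
Proof.
move=> xs [u [u_s u_x u_new]]; set B := ~: _.
have def_B' : ~: [set:: s] = x |: B.
  apply/setP=> y; rewrite !inE mem_rcons inE negb_or.
  by case: eqVneq => // ->; rewrite xs.
have uB : u \notin B by rewrite !inE negbK.
(* By symmetry [u] has no neighbour in [s], and the white vertices are those of [s] together with
   [x]. *)
have white_u y : (e u y && (y \notin B)) = e u y && (y == x).
  rewrite !inE negbK mem_rcons inE; case: eqVneq => //= _; rewrite andbF.
  by apply/andP=> -[e_uy /u_new]; rewrite e_sym e_uy.
rewrite /TD_step /= def_B'; apply/orP.
move: u_x; rewrite !inE => /orP[/eqP def_u|e_xu].
  right; apply/existsP; exists x; rewrite -{1}def_u uB eqxx andbT /=.
  apply/subsetP=> y; rewrite inE -def_u => e_uy; apply/negPn/negP=> yB.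
  (* A white neighbour of [u] could only be [x], which here is [u] itself: a loop. *)
  have := white_u y; rewrite e_uy yB /= => /esym/eqP eq_yx.
  by rewrite def_u eq_yx e_irr in e_uy.
left; apply/existsP; exists u; apply/existsP; exists x.
rewrite uB eqxx andbT /=; apply/eqP/setP=> y.
rewrite in_setD in_set1 [y \in open_nbhd e u]inE andbC white_u.
by case: eqVneq => [->|_]; rewrite ?andbF // e_sym e_xu.
Qed.

(** Either rule turns a single white vertex [x] blue, so the white set before the step is [s] with
    [x] added. The witness is the vertex at which the rule is applied. *)
Lemma step_footprints B s : TD_step e B (~: [set:: s]) ->
  exists x, [/\ x \notin s, footprints s x & B = ~: [set:: rcons s x]].
Proof.
have add_x x : x \notin B -> ~: [set:: s] = x |: B ->
    (x \notin s) * (B = ~: [set:: rcons s x]) * (forall y, y \in s -> y \notin B).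
  move=> xB /setP def_B'; have := def_B' x; rewrite !inE eqxx => /= -> //.
  split; first split=> //.
    apply/setP=> y; rewrite !inE mem_rcons inE negb_or.
    have := def_B' y; rewrite !inE => ->.
    by case: eqVneq => // ->; rewrite (negPf xB).
  move=> y ys; apply/negP=> yB; have := def_B' y.
  by rewrite !inE ys yB orbT.
case/orP=> [/existsP[v /existsP[w /and3P[vB /eqP/setP Nv /eqP def_B']]]|].
  have := Nv w; rewrite !inE eqxx => /andP[wB e_vw].
  have [[ws def_B] sB] := add_x w wB def_B'.
  exists w; split=> //; exists v; split.
  - by move: vB; rewrite {1}def_B !inE negbK.
  - by rewrite !inE e_sym e_vw orbT.
  (* A neighbour of [v] in [s] is white before the step, hence equals [w], which lies outside
     [s]. *)
  move=> y ys; apply/negP=> e_yv; have := Nv y.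
  rewrite !inE sB // e_sym e_yv => /esym/eqP eq_yw.
  by rewrite eq_yw (negPf ws) in ys.
case/existsP=> v /and3P[vB /subsetP Nv /eqP def_B'].
have [[vs def_B] sB] := add_x v vB def_B'.
exists v; split=> //; exists v; split.
- by rewrite mem_rcons mem_head.
- by rewrite !inE eqxx.
move=> y ys; apply/negP=> e_yv.
by have := sB y ys; rewrite Nv // inE e_sym.
Qed.

Lemma L_seq_forcing s : L_seq s -> TD_forcing_set e (~: [set:: s]).
Proof.
elim=> [|{}s x _ fs xs fx].
  have ->: ~: [set:: [::]] = [set: V] by apply/setP=> y; rewrite !inE.
  exact: connect0.
exact: connect_trans (connect1 (footprints_step xs fx)) fs.
Qed.

(** Induction on the colouring path: the tail of the path yields [s], and the first step appends its
    vertex at the end. *)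
Lemma forcing_L_seq S :
  TD_forcing_set e S -> exists2 s, L_seq s & S = ~: [set:: s].
Proof.
case/connectP=> p; elim: p S => [|B p IH] S /=.
  by move=> _ <-; exists [::]; [constructor | apply/setP=> y; rewrite !inE].
case/andP=> st /IH{}IH /IH[s Ls def_B].
rewrite def_B in st; have [x [xs fx ->]] := step_footprints st.
by exists (rcons s x) => //; constructor.
Qed.

Lemma card_setC_seq (s : seq V) :
  uniq s -> #|~: [set:: s]| + size s = #|V|.
Proof.
by move=> us; rewrite -(cardsC [set:: s]) addnC [#|[set:: s]|]cardsE (card_uniqP us).
Qed.

End Footprints.

Unset Implicit Arguments.

Theorem theorem23 (V : finType) (e : rel V)
    (e_sym : symmetric e) (e_irr : irreflexive e)
    (n k : nat) (card_V : #|V| = n) :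
  (exists s : k.-tuple V, local_L_sequence e s) <->
  (exists S : {set V}, TD_forcing_set e S /\ #|S| + k = n).
Proof.
rewrite -card_V; split=> [[s /local_L_sequenceP Ls]|[S [/forcing_L_seq fS]]].
  exists (~: [set:: s]); split; first exact: L_seq_forcing.
  by rewrite -(card_setC_seq (L_seq_uniq Ls)) size_tuple.
have [//|s Ls ->] := fS.
(* Cancelling the number of blue vertices identifies [k] with [size s], so [s] is a [k]-tuple
   without any cast. *)
rewrite -(card_setC_seq (L_seq_uniq Ls)) => /addnI def_k; subst k.
by exists (in_tuple s); apply/local_L_sequenceP.
Qed.
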